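(* Let $t$ be a positive integer and $\lambda=(\lambda_1,\dots,\lambda_r)$ a partition, and set $n=(r-1)t+\lambda_1$. Let $\Sigma_t^\lambda$ denote the Alexander dual of the $t$-Young complex $\Delta_t^\lambda$ (regarded as a simplicial complex on $[n]$). Then the Stanley--Reisner ideal of $\Sigma_t^\lambda$ is generated by a subset of the minimal monomial generators of $I_{(r-1)t+\lambda_1,\,t}^{[r-1]}$. In particular, the Helly number of $\Sigma_t^\lambda$ is $$h(\Sigma_t^\lambda)=(r-1)t-1.$$
   Context: A partition $\lambda=(\lambda_1\ge\dots\ge\lambda_r\ge1)$ is identified with its Young diagram (top- and left-justified, $\lambda_j$ boxes in row $j$, row $1$ on top). For a positive integer $t$, fill the box in row $j$, column $i$ with $(r-j)t+i$. The $t$-Young complex $\Delta_t^\lambda$ is the simplicial complex whose facets are all sets $\{a_1<\dots<a_{\lambda_1}\}$ such that $a_j$ is an entry of the $j$-th column of $\lambda$ for every $1\le j\le\lambda_1$. The Alexander dual of a complex $\Delta$ on $[n]=\{1,\dots,n\}$ is $\{[n]\setminus F: F\subseteq[n],\ F\notin\Delta\}$. The Stanley--Reisner ideal of a complex $\Delta$ on $[n]$ is the ideal of $K[x_1,\dots,x_n]$ ($K$ a field) generated by $\prod_{i\in F}x_i$ for $F\notin \Delta$; its minimal generators correspond to the minimal non-faces. The Helly number $h(\Delta)$ is the maximal dimension of a minimal non-face of $\Delta$, where $\dim F=|F|-1$ (equivalently, one less than the maximal degree of a minimal generator of the Stanley--Reisner ideal). $I_{n,t}$ is the $t$-path ideal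 of the path graph on $[n]$, generated by $x_ix_{i+1}\cdots x_{i+t-1}$ for $1\le i\le n-t+1$. For $k\ge1$, its $k$-th squarefree power $I_{n,t}^{[k]}$ is generated by the squarefree monomials in the minimal generating set of $I_{n,t}^k$, i.e. by products of $k$ of these generators with pairwise disjoint supports; for $k=0$ one takes $I_{n,t}^{[0]}=(1)$. *)

(* Defs.v *)
From mathcomp Require Import all_boot all_order all_algebra.
From mathcomp Require Import mpoly.

Set Implicit Arguments.
Unset Strict Implicit.
Unset Printing Implicit Defensive.

Import Order.TTheory GRing.Theory Num.Theory.
Local Open Scope ring_scope.

(* The vertex set [n] = {1, ..., n} is represented by 'I_n, the ordinal v
   standing for the vertex v + 1. Rows and columns of a Young diagram are
   numbered from 0 as well. *)

Section Complexes.
Variable T : finType.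
Implicit Types (D : {set {set T}}) (F G : {set T}).

(* The void complex set0 is allowed; it is the Alexander dual of a simplex. *)
Definition simplicial_complex D :=
  forall F G, G \subset F -> F \in D -> G \in D.

Definition facets D : {set {set T}} := [set F | maxset (fun G => G \in D) F].

Definition alexander_dual D : {set {set T}} := [set ~: F | F in ~: D].

Definition minimal_nonfaces D : {set {set T}} := [set F | minset (fun G => G \notin D) F].

Definition dim_face F : int := #|F|%:Z - 1.

Definition is_helly_number D (h : int) :=
  (exists2 F, F \in minimal_nonfaces D & dim_face F = h) /\
  (forall F, F \in minimal_nonfaces D -> dim_face F <= h).

Lemma alexander_dual_complex D :
  simplicial_complex D -> simplicial_complex (alexander_dual D).
Proof.
move=> hD F G sGF /imsetP[A nA eF]; rewrite -[G]setCK; apply: imset_f.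
rewrite inE in nA; rewrite inE; apply: contra nA; apply: hD.
by rewrite -setCS -eF setCK.
Qed.

End Complexes.

Section YoungComplex.
Variables (n t : nat) (la : seq nat).

Definition is_partition := sorted geq la && (0%N \notin la).

(* In 1-based terms the box in row j + 1 and column i + 1 has the entry
   (r - (j + 1)) t + (i + 1), which is the vertex (r - (j + 1)) t + i of 'I_n. *)
Definition column_entry (i : nat) (v : 'I_n) : bool :=
  [exists j : 'I_(size la),
     (i < nth 0 la j)%N && (v == (size la - j.+1) * t + i :> nat)%N].

Definition increasing_section (l : nat) (a : {ffun 'I_l -> 'I_n}) : bool :=
  [forall i : 'I_l, forall j : 'I_l, (i < j)%N ==> (a i < a j)%N]
  && [forall i : 'I_l, column_entry i (a i)].

Definition young_facets : {set {set 'I_n}} :=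
  [set [set a i | i : 'I_(head 0%N la)] |
     a : {ffun 'I_(head 0%N la) -> 'I_n} & increasing_section a].

Definition young_complex : {set {set 'I_n}} :=
  [set F : {set 'I_n} | [exists G in young_facets, F \subset G]].

Lemma young_complex_complex : simplicial_complex young_complex.
Proof.
move=> F G sGF; rewrite !inE => /existsP[A /andP[hA sFA]].
by apply/existsP; exists A; rewrite hA (subset_trans sGF).
Qed.

Lemma card_young_facet F : F \in young_facets -> #|F| = head 0%N la.
Proof.
move=> /imsetP[a]; rewrite inE => /andP[/forallP ha _] ->.
rewrite card_imset ?card_ord // => i j eij; apply: val_inj => /=.
have lt (k l : 'I_(head 0%N la)) : (k < l)%N -> a k = a l -> False.
  by move=> kl e; have /forallP/(_ l) := ha k; rewrite kl e ltnn.
by case: (ltngtP i j) => // [/lt/(_ eij)|/lt/(_ (esym eij))].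
Qed.

Lemma facets_young_complex : facets young_complex = young_facets.
Proof.
apply/setP => F; rewrite inE; apply/idP/idP => [/maxsetP[]|hF].
  rewrite !inE => /existsP[A /andP[hA sFA]] hmax.
  rewrite -(hmax A) // inE; apply/existsP; exists A; rewrite hA /=; exact: subxx.
apply/maxsetP; split=> [|B].
  by rewrite inE; apply/existsP; exists F; rewrite hF subxx.
rewrite inE => /existsP[A /andP[hA sBA]] sFB; apply/esym/eqP.
by rewrite eqEcard sFB (card_young_facet hF) -(card_young_facet hA) subset_leq_card.
Qed.

End YoungComplex.

(* Ideals are represented by their membership predicates. *)
Section Ideals.
Variable R : comNzRingType.

Definition ideal_gen (S : R -> Prop) (p : R) : Prop :=
  exists (m : nat) (c g : 'I_m -> R),
    (forall i, S (g i)) /\ p = \sum_i c i * g i.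

Definition ideal_pow (I : R -> Prop) (k : nat) : R -> Prop :=
  ideal_gen (fun p => exists2 f : 'I_k -> R,
                        (forall i, I (f i)) & p = \prod_i f i).

End Ideals.

Section MonomialIdeals.
Variables (K : fieldType) (n : nat).
Implicit Types (I : {mpoly K[n]} -> Prop) (S : 'X_{1..n} -> Prop).

Definition monomial_ideal S : {mpoly K[n]} -> Prop :=
  ideal_gen (fun p => exists2 m, S m & p = 'X_[m]).

(* The minimal monomial generators of a monomial ideal I are the monomials of I
   that are minimal for divisibility; (m1 <= m2)%MM is divisibility. *)
Definition min_generator I (m : 'X_{1..n}) : Prop :=
  I 'X_[m] /\ forall m', I 'X_[m'] -> (m' <= m)%MM -> m' = m.

Definition squarefree (m : 'X_{1..n}) : Prop := forall i, (m i <= 1)%N.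

Definition squarefree_pow I (k : nat) : {mpoly K[n]} -> Prop :=
  monomial_ideal (fun m => min_generator (ideal_pow I k) m /\ squarefree m).

Definition path_ideal (t : nat) : {mpoly K[n]} -> Prop :=
  ideal_gen (fun p => exists2 i : nat, (i + t <= n)%N
                        & p = \prod_(j < n | (i <= j < i + t)%N) 'X_j).

Definition stanley_reisner (D : {set {set 'I_n}}) : {mpoly K[n]} -> Prop :=
  ideal_gen (fun p => exists2 F : {set 'I_n}, F \notin D
                        & p = \prod_(i in F) 'X_i).

End MonomialIdeals.

Arguments path_ideal K n t : clear implicits.
Arguments stanley_reisner K [n] D.

(* Main.v *)
Require Import Defs.
From mathcomp Require Import all_boot all_order all_algebra.
From mathcomp Require Import mpoly.
From mathcomp Require Import zify.

(** A facet has entries [a_i = c_i t + i], and it increases exactly when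
    [c_0 <= c_1 <= ...].  The gaps left by such a set in [[n]] have lengths
    divisible by [t], so its complement is a disjoint union of [r - 1] intervals
    of length [t], i.e. the support of a squarefree product of [r - 1] path
    generators.  The non-faces of the Alexander dual are the supersets of these
    complements, which all have [(r - 1) t] elements; minimality then follows by
    comparing degrees. *)

Set Implicit Arguments.
Unset Strict Implicit.
Unset Printing Implicit Defensive.

Import Order.TTheory GRing.Theory Num.Theory.
Local Open Scope ring_scope.

(** * Non-faces of an Alexander dual *)

Section AlexanderDual.
Variable T : finType.
Implicit Types (D : {set {set T}}) (F : {set T}).

Lemma notin_alexander_dual D F : (F \notin alexander_dual D) = (~: F \in D).
Proof.
rewrite -[F]setCK /alexander_dual mem_imset; last exact: setC_inj.
by rewrite inE negbK !setCK.
Qed.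

End AlexanderDual.

(** * Initial segments and intervals of ['I_n] *)

Section Ordinals.
Local Open Scope nat_scope.

Lemma card_ord_lt n m : m <= n -> #|[set i : 'I_n | i < m]| = m.
Proof.
move=> le_mn; rewrite -sum1dep_card.
by rewrite -(big_ord_widen n (fun=> 1) le_mn) sum1_card card_ord.
Qed.

(** If [i] is in [P], so are the [i + 1] elements up to [i]; otherwise [P] lies among the [i]
    elements below [i]. *)
Lemma down_closed_card n (P : {set 'I_n}) :
  (forall i j : 'I_n, i <= j -> j \in P -> i \in P) ->
  forall i, (i \in P) = (i < #|P|).
Proof.
move=> dP i; apply/idP/idP => [Pi | lt_iP].
  rewrite -[i.+1](@card_ord_lt n) //; apply: subset_leq_card.
  by apply/subsetP => j; rewrite inE ltnS => /dP; apply.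
apply: contraLR lt_iP => nPi; rewrite -leqNgt.
rewrite -[leqRHS](card_ord_lt (ltnW (ltn_ord i))); apply: subset_leq_card.
apply/subsetP => j Pj; rewrite inE ltnNge; apply: contra nPi => /dP; exact.
Qed.

Definition ord_interval n (u t : nat) : {set 'I_n} :=
  [set j : 'I_n | u <= j < u + t].

Lemma card_ord_interval n u t : u + t <= n -> #|ord_interval n u t| = t.
Proof.
move=> le_n; have -> : ord_interval n u t =
    [set i : 'I_n | i < u + t] :\: [set i : 'I_n | i < u].
  by apply/setP => i; rewrite !inE -leqNgt.
rewrite cardsDS; last by apply/subsetP => i; rewrite !inE; lia.
by rewrite !card_ord_lt; lia.
Qed.

Lemma card_bigcup_ord_interval n t k (u : 'I_k -> nat) :
  (forall i, u i + t <= n) ->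
  (forall i j, i != j ->
     [disjoint ord_interval n (u i) t & ord_interval n (u j) t]) ->
  #|\bigcup_i ord_interval n (u i) t| = k * t.
Proof.
move=> u_le u_disj; rewrite -sum1_card (partition_disjoint_bigcup _ _ u_disj).
under eq_bigr => i _ do rewrite sum1_card card_ord_interval //.
by rewrite sum_nat_const card_ord.
Qed.

(** Each step raises [a] by at least one. For a facet this makes [a i - i] weakly increasing. *)
Lemma ord_increasing_sub_le l (a : 'I_l -> nat) :
  (forall i j : 'I_l, i < j -> a i < a j) ->
  forall i j : 'I_l, i <= j -> a i + (j - i) <= a j.
Proof.
move=> inc_a i [j]; elim: j => [|j IHj] lt_j /= le_ij.
  have -> : i = Ordinal lt_j by apply: val_inj => /=; lia.
  by lia.
have [eq_ij | lt_ij] := eqVneq (i : nat) j.+1.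
  have -> : i = Ordinal lt_j by apply: val_inj.
  by rewrite /=; lia.
have lt_jl : j < l by lia.
have := IHj lt_jl; have := inc_a (Ordinal lt_jl) (Ordinal lt_j) (ltnSn _).
by rewrite /=; lia.
Qed.

End Ordinals.

(** * Facets of the Young complex and their complements *)

Section YoungFacets.
Local Open Scope nat_scope.
Variables (n t : nat) (la : seq nat).
Hypothesis nE : n = (size la - 1) * t + head 0 la.

Lemma young_facet_setC A : 0 < t -> A \in young_facets n t la ->
  exists u : 'I_(size la - 1) -> nat,
    [/\ forall k, u k + t <= n,
        forall k k', k != k' ->
          [disjoint ord_interval n (u k) t & ord_interval n (u k') t]
      & ~: A = \bigcup_k ord_interval n (u k) t].
Proof.
move=> t_gt0 facetA; have cardA := card_young_facet facetA.
move: facetA => /imsetP[a /[!inE] /andP[/forallP inc_a /forallP col_a] eA].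
(* [c i] is the row of the entry [a i], counted from 0 at the bottom; the division is exact. *)
pose c (i : 'I_(head 0 la)) := (a i - i) %/ t.
have aE i : a i = c i * t + i :> nat.
  have /existsP[j /andP[_ /eqP eij]] := col_a i.
  by rewrite /c eij addnK mulnK.
have c_mono (i j : 'I_(head 0 la)) : i <= j -> c i <= c j.
  move=> le_ij; apply: leq_div2r.
  have inc (i' j' : 'I_(head 0 la)) : i' < j' -> a i' < a j'.
    by move=> lt_ij; have /forallP/(_ j')/implyP := inc_a i'; apply.
  have := ord_increasing_sub_le inc le_ij; lia.
(* As [c] is weakly increasing, the columns with [c i <= k] are the first [s k] ones. *)
pose s k := #|[set i | c i <= k]|.
have sP i k : (c i <= k) = (i < s k).
  rewrite -down_closed_card ?inE // => i' j le_ij; rewrite !inE.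
  exact/leq_trans/c_mono.
have s_mono k k' : k <= k' -> s k <= s k'.
  move=> le_k; apply/subset_leq_card/subsetP => i; rewrite !inE => /leq_trans.
  exact.
have s_le k : s k <= head 0 la by rewrite -[leqRHS]card_ord max_card.
(* The [k]-th interval is preceded by [k] intervals and by the [s k] entries of
   [A] with [c i <= k]. *)
pose u (k : 'I_(size la - 1)) := k * t + s k.
have u_le k : u k + t <= n.
  rewrite nE /u; have := s_le k; have := leq_mul (ltn_ord k) (leqnn t).
  by rewrite mulSn; lia.
have u_disj_lt (k k' : 'I_(size la - 1)) : k < k' -> u k + t <= u k'.
  move=> lt_k; rewrite /u; have := leq_mul lt_k (leqnn t).
  by rewrite mulSn; have := s_mono _ _ (ltnW lt_k); lia.
have u_disj (k k' : 'I_(size la - 1)) : k != k' ->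
    [disjoint ord_interval n (u k) t & ord_interval n (u k') t].
  move=> neq_k; rewrite -setI_eq0; apply/eqP/setP => j; rewrite !inE.
  have [/u_disj_lt|/u_disj_lt|eq_k] := ltngtP k k'; [lia|lia|].
  by rewrite (val_inj eq_k) eqxx in neq_k.
(* Both sides have [(r - 1) t] elements, so it is enough that no interval meets [A]. *)
exists u; split=> //; apply/esym/eqP; rewrite eqEcard; apply/andP; split.
  apply/bigcupsP => k _; apply/subsetP => j; rewrite !inE => j_itv.
  apply/negP; rewrite eA => /imsetP[i _ eji].
  move: j_itv; rewrite eji aE /u => /andP[le_ua lt_au].
  (* If [c i <= k] then [i < s k], and [a i] lies before the [k]-th interval; otherwise
     [c i >= k + 1] and [i >= s k], and [a i] lies past its end. *)
  have [le_ck | lt_kc] := leqP (c i) k.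
    have lt_is : i < s k by rewrite -sP.
    by move: le_ua; rewrite leqNgt -addnS leq_add // leq_mul2r le_ck orbT.
  have le_si : s k <= i by rewrite leqNgt -sP -ltnNge.
  move: lt_au; rewrite addnAC -mulSnr ltnNge leq_add //.
  by rewrite leq_mul2r lt_kc orbT.
rewrite card_bigcup_ord_interval //.
by have := cardsC A; rewrite card_ord cardA [X in _ = X]nE; lia.
Qed.

Lemma card_setC_young_facet A :
  A \in young_facets n t la -> #|~: A| = (size la - 1) * t.
Proof.
move=> /card_young_facet cardA.
by have := cardsC A; rewrite card_ord cardA [X in _ = X]nE; lia.
Qed.

Lemma notin_dual_youngP (F : {set 'I_n}) :
  reflect (exists2 A, A \in young_facets n t la & ~: A \subset F)
          (F \notin alexander_dual (young_complex n t la)).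
Proof.
rewrite notin_alexander_dual inE.
apply: (iffP existsP) => [[A /andP[fA sFA]] | [A fA sAF]]; exists A => //.
  by rewrite -setCS setCK.
by rewrite fA -setCS setCK.
Qed.

(** A non-face contains the complement of a facet, itself a non-face; minimality forces equality. *)
Lemma card_minimal_nonface_dual_young (F : {set 'I_n}) :
  F \in minimal_nonfaces (alexander_dual (young_complex n t la)) ->
  #|F| = (size la - 1) * t.
Proof.
rewrite inE => /minsetP[/notin_dual_youngP[A fA sAF] minF].
rewrite -(minF _ _ sAF) ?card_setC_young_facet //.
by apply/notin_dual_youngP; exists A.
Qed.

(** A non-face inside [~: A] contains the complement of some facet, which already has as many
    elements as [~: A]. *)
Lemma setC_young_facet_minimal_nonface A : A \in young_facets n t la ->
  ~: A \in minimal_nonfaces (alexander_dual (young_complex n t la)).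
Proof.
move=> fA; rewrite inE; apply/minsetP; split.
  by apply/notin_dual_youngP; exists A.
move=> B /notin_dual_youngP[A' fA' sAB] sBA; apply/eqP.
by rewrite eqEcard sBA card_setC_young_facet // -(card_setC_young_facet fA')
           subset_leq_card.
Qed.

(** The top row, which meets every column, is a facet. *)
Lemma young_facet_exists : la != [::] -> exists A, A \in young_facets n t la.
Proof.
move=> la_nonempty; have la_gt0 : 0 < size la by rewrite lt0n size_eq0.
have bound (i : 'I_(head 0 la)) : (size la - 1) * t + i < n.
  by rewrite nE ltn_add2l.
exists [set [ffun i => Ordinal (bound i)] i | i : 'I_(head 0 la)].
apply: imset_f; rewrite inE; apply/andP; split; apply/forallP => i.
  by apply/forallP => j; apply/implyP; rewrite !ffunE /= ltn_add2l.
by apply/existsP; exists (Ordinal la_gt0); rewrite ffunE /= nth0 ltn_ord /=.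
Qed.

Lemma helly_number_dual_young : la != [::] ->
  is_helly_number (alexander_dual (young_complex n t la))
    (((size la - 1) * t)%:Z - 1)%R.
Proof.
move=> la_nonempty; split=> [|F]; last first.
  by move=> /card_minimal_nonface_dual_young; rewrite /dim_face => ->.
have [A fA] := young_facet_exists la_nonempty.
exists (~: A); first exact: setC_young_facet_minimal_nonface.
by rewrite /dim_face card_setC_young_facet.
Qed.

End YoungFacets.

(** * Generated ideals *)

Section IdealGen.
Variable R : comNzRingType.
Implicit Types (S I : R -> Prop) (p q : R).

Lemma ideal_gen_in S p : S p -> ideal_gen S p.
Proof. by move=> Sp; exists 1, (fun=> 1), (fun=> p); rewrite big_ord1 mul1r. Qed.

(** Only multiples of generators are tested, so [I] need not be known to be an ideal beforehand. *)
Lemma ideal_gen_min S I :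
  I 0 -> (forall p q, I p -> I q -> I (p + q)) ->
  (forall c p, S p -> I (c * p)) -> forall p, ideal_gen S p -> I p.
Proof.
move=> I0 ID IM p [m [c [g [Sg ->]]]].
by apply: big_ind => // i _; apply: IM.
Qed.

Lemma ideal_gen0 S : ideal_gen S 0.
Proof. by exists 0, (fun=> 0), (fun=> 0); split=> [[]|] //; rewrite big_ord0. Qed.

Lemma ideal_genD S p q : ideal_gen S p -> ideal_gen S q -> ideal_gen S (p + q).
Proof.
move=> [m [c [g [Sg ->]]]] [m' [c' [g' [Sg' ->]]]].
pose glue (f : 'I_m -> R) (f' : 'I_m' -> R) i :=
  match split i with inl j => f j | inr j => f' j end.
exists (m + m')%N, (glue c c'), (glue g g'); split=> [i|].
  by rewrite /glue; case: (split i).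
rewrite big_split_ord /=; congr (_ + _); apply: eq_bigr => i _.
  by rewrite /glue (unsplitK (inl _ i)).
by rewrite /glue (unsplitK (inr _ i)).
Qed.

Lemma ideal_genM S c p : ideal_gen S p -> ideal_gen S (c * p).
Proof.
move=> [m [d [g [Sg ->]]]]; exists m, (fun i => c * d i), g; split=> //.
by rewrite mulr_sumr; apply: eq_bigr => i _; rewrite mulrA.
Qed.

Lemma ideal_gen_sub S S' : (forall p, S p -> ideal_gen S' p) ->
  forall p, ideal_gen S p -> ideal_gen S' p.
Proof.
move=> sSS'; apply: ideal_gen_min => [|p q|c p /sSS'].
- exact: ideal_gen0.
- exact: ideal_genD.
- exact: ideal_genM.
Qed.

End IdealGen.

(** * Lower bounds on degrees, and squarefree monomials *)

Section OrderBound.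
Variables (K : fieldType) (n : nat).
Implicit Types (p q : {mpoly K[n]}) (m : 'X_{1..n}) (F G : {set 'I_n}).

(** Membership in the [d]-th power of the ideal of all variables; the zero polynomial satisfies
    every bound. *)
Definition order_ge d p := forall m, m \in msupp p -> (d <= mdeg m)%N.

Lemma order_ge0 p : order_ge 0 p. Proof. by []. Qed.

Lemma order_geM d e p q :
  order_ge d p -> order_ge e q -> order_ge (d + e) (p * q).
Proof.
move=> dp eq m /msuppM_le /allpairsP[[m1 m2] /= [/dp le1 /eq le2 ->]].
by rewrite mdegD leq_add.
Qed.

Lemma order_ge_prod d k (f : 'I_k -> {mpoly K[n]}) :
  (forall i, order_ge d (f i)) -> order_ge (k * d) (\prod_i f i).
Proof.
elim: k f => [|k IHk] f df; first exact: order_ge0.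
by rewrite big_ord_recl mulSn; apply: order_geM => //; apply: IHk.
Qed.

Lemma order_ge_ideal_gen d (S : {mpoly K[n]} -> Prop) :
  (forall p, S p -> order_ge d p) -> forall p, ideal_gen S p -> order_ge d p.
Proof.
move=> dS; apply: ideal_gen_min => [m|p q dp dq m|c p /dS].
- by rewrite msupp0.
- by move=> /msuppD_le; rewrite mem_cat => /orP[/dp|/dq].
(* The coefficient [c] counts as a factor of order at least 0. *)
- exact/(@order_geM 0)/order_ge0.
Qed.

Lemma order_geX d m : order_ge d 'X_[m] <-> (d <= mdeg m)%N.
Proof.
split=> [|le_d m' /mem_msuppXP <- //].
by apply; rewrite msuppX mem_head.
Qed.

Definition set_mnm F : 'X_{1..n} := [multinom (i \in F : nat) | i < n].

Lemma prod_set_mnm F : \prod_(i in F) 'X_i = 'X_[K, set_mnm F].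
Proof.
rewrite mpolyXE_id big_mkcond; apply: eq_bigr => i _.
by rewrite mnmE; case: (i \in F).
Qed.

Lemma mdeg_set_mnm F : mdeg (set_mnm F) = #|F|.
Proof.
rewrite mdegE -sum1_card [RHS]big_mkcond; apply: eq_bigr => i _.
by rewrite mnmE; case: (i \in F).
Qed.

Lemma squarefree_set_mnm F : squarefree (set_mnm F).
Proof. by move=> i; rewrite mnmE leq_b1. Qed.

Lemma lem_set_mnm F G : F \subset G -> (set_mnm F <= set_mnm G)%MM.
Proof.
move=> /subsetP sFG; apply/mnm_lepP => i; rewrite !mnmE.
by case: (boolP (i \in F)) => // /sFG ->.
Qed.

(** The quotient monomial has degree 0. *)
Lemma lem_mdeg_eq m m' : (m' <= m)%MM -> (mdeg m <= mdeg m')%N -> m' = m.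
Proof.
move=> /submK <-; rewrite mdegD -[leqRHS]add0n leq_add2r leqn0 mdeg_eq0.
by move=> /eqP ->; rewrite add0m.
Qed.

(** A monomial of least degree in [I] has no proper divisor in [I]. *)
Lemma order_ge_min_generator (I : {mpoly K[n]} -> Prop) m :
  I 'X_[m] -> (forall p, I p -> order_ge (mdeg m) p) -> min_generator I m.
Proof.
move=> Im dI; split=> // m' /dI /order_geX le_deg le_m'; exact: lem_mdeg_eq.
Qed.

End OrderBound.

(** * Squarefree powers of path ideals *)

Section PathIdeal.
Variables (K : fieldType) (n t k : nat).
Implicit Types p : {mpoly K[n]}.

Lemma order_ge_path_ideal p : path_ideal K n t p -> order_ge t p.
Proof.
apply: order_ge_ideal_gen => _ [u le_un ->].
have -> : \prod_(j < n | (u <= j < u + t)%N) 'X_j =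
          'X_[K, set_mnm (ord_interval n u t)].
  by rewrite -prod_set_mnm; apply: eq_bigl => j; rewrite inE.
by apply/order_geX; rewrite mdeg_set_mnm card_ord_interval.
Qed.

Lemma order_ge_path_ideal_pow p :
  ideal_pow (path_ideal K n t) k p -> order_ge (k * t) p.
Proof.
apply: order_ge_ideal_gen => _ [f If ->].
by apply: order_ge_prod => i; apply: order_ge_path_ideal.
Qed.

Lemma order_ge_path_squarefree_pow p :
  squarefree_pow (path_ideal K n t) k p -> order_ge (k * t) p.
Proof.
apply: order_ge_ideal_gen => _ [m [[Im _] _] ->].
exact: order_ge_path_ideal_pow.
Qed.

(** The degree [k t] is least possible both in the ordinary power and in the squarefree power, so
    the degree criterion applies to each in turn. *)
Lemma min_generator_path_squarefree_pow (u : 'I_k -> nat) :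
  (forall i, u i + t <= n)%N ->
  (forall i j, i != j ->
     [disjoint ord_interval n (u i) t & ord_interval n (u j) t]) ->
  min_generator (squarefree_pow (path_ideal K n t) k)
    (set_mnm (\bigcup_i ord_interval n (u i) t)).
Proof.
move=> u_le u_disj; set m := set_mnm _.
have deg_m : mdeg m = (k * t)%N.
  by rewrite mdeg_set_mnm card_bigcup_ord_interval.
apply: order_ge_min_generator => [|p]; last first.
  by rewrite deg_m; apply: order_ge_path_squarefree_pow.
apply: ideal_gen_in; exists m => //; split; last exact: squarefree_set_mnm.
apply: order_ge_min_generator => [|p]; last first.
  by rewrite deg_m; apply: order_ge_path_ideal_pow.
apply: ideal_gen_in.
(* Disjointness splits the monomial into [k] path generators, one for each interval. *)
rewrite /m -prod_set_mnm (partition_disjoint_bigcup _ _ u_disj).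
eexists; last reflexivity.
move=> i; apply: ideal_gen_in; exists (u i) => //.
by apply: eq_bigl => j; rewrite inE.
Qed.

End PathIdeal.

(** * Generators and Helly number of the dual *)

Theorem corollary3p2 (K : fieldType) (t : nat) (la : seq nat)
    (t_gt0 : (0 < t)%N) (la_part : is_partition la) (la_nonempty : la != [::]) :
  let r := size la in
  let n := ((r - 1) * t + head 0 la)%N in
  let Sigma := alexander_dual (young_complex n t la) in
  (exists2 S : 'X_{1..n} -> Prop,
     (forall m, S m ->
        min_generator (squarefree_pow (path_ideal K n t) (r - 1)) m) &
     (forall p, stanley_reisner K Sigma p <-> monomial_ideal S p)) /\
  is_helly_number Sigma (((r - 1) * t)%N%:Z - 1).
Proof.
move=> r n Sigma; split; last exact: helly_number_dual_young.
exists (fun m => exists2 A, A \in young_facets n t la & m = set_mnm (~: A)).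
  move=> _ [A fA ->].
  have [u [u_le u_disj ->]] := young_facet_setC (erefl n) t_gt0 fA.
  exact: min_generator_path_squarefree_pow.
move=> p; split; apply: ideal_gen_sub => q.
  (* The monomial of a non-face is a multiple of the monomial of the facet complement that it
     contains. *)
  move=> [F /notin_dual_youngP[A fA sAF] ->].
  rewrite prod_set_mnm -(submK (lem_set_mnm sAF)) mpolyXD.
  by apply/ideal_genM/ideal_gen_in; exists (set_mnm (~: A)) => //; exists A.
move=> [_ [A fA ->] ->]; apply: ideal_gen_in; exists (~: A).
  by apply/notin_dual_youngP; exists A.
by rewrite prod_set_mnm.
Qed.
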